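(* For $i=1,2$, suppose $\alpha_i,\beta_i,\gamma_i,\eta_i$ are positive real numbers such that $\alpha_i,\beta_i>\gamma_i$. Then the analytic Hilbert modules $\mathbb{H}^{(\alpha_1,\beta_1,\gamma_1,\eta_1)}$ and $\mathbb{H}^{(\alpha_2,\beta_2,\gamma_2,\eta_2)}$ are unitarily equivalent if and only if $$\frac{\alpha_1}{\alpha_2}=\frac{\beta_1}{\beta_2}=\frac{\gamma_1}{\gamma_2}=\frac{\eta_2}{\eta_1}.$$
   Context: $\mathbb{D}$ is the open unit disc in $\mathbb{C}$. For $\alpha,\beta>\gamma>0$ let $$B_{(\alpha,\beta,\gamma)}(\boldsymbol z,\boldsymbol w)=(1-z_1\overline{w}_1)^{-\alpha}(1-z_2\overline{w}_2)^{-\beta}(1-z_1\overline{w}_2)^{\gamma}(1-z_2\overline{w}_1)^{\gamma}$$ (principal branches), and for $\eta>0$ let $$\mathcal{B}^{(\alpha,\beta,\gamma,\eta)}(\boldsymbol z,\boldsymbol w)=\big[B_{(\alpha,\beta,\gamma)}(\boldsymbol z,\boldsymbol w)\big]^{\eta}\left(\frac{\partial^2}{\partial z_i\partial\overline{w}_j}\log B_{(\alpha,\beta,\gamma)}(\boldsymbol z,\boldsymbol w)\right)_{i,j=1}^2 ,$$ where $[B_{(\alpha,\beta,\gamma)}]^{\eta}=B_{(\alpha\eta,\beta\eta,\gamma\eta)}$. Explicitly, $$\det\mathcal{B}^{(\alpha,\beta,\gamma,\eta)}(\boldsymbol z,\boldsymbol w)=(1-z_1\overline{w}_1)^{-2\alpha\eta}(1-z_2\overline{w}_2)^{-2\beta\eta}(1-z_1\overline{w}_2)^{2\gamma\eta}(1-z_2\overline{w}_1)^{2\gamma\eta}\left[\frac{\alpha\beta}{(1-z_1\overline{w}_1)^2(1-z_2\overline{w}_2)^2}-\frac{\gamma^2}{(1-z_1\overline{w}_2)^2(1-z_2\overline{w}_1)^2}\right].$$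 This function is non-negative definite, and $\mathbb{H}^{(\alpha,\beta,\gamma,\eta)}$ is the Hilbert space of holomorphic functions on $\mathbb{D}^2$ with reproducing kernel $\det\mathcal{B}^{(\alpha,\beta,\gamma,\eta)}$. It is an analytic Hilbert module: polynomials are contained and dense in it, and the operators $M_{z_1},M_{z_2}$ of multiplication by the coordinate functions are bounded. Two analytic Hilbert modules $\mathcal{H},\mathcal{H}'$ on $\mathbb{D}^2$ are unitarily equivalent if there is a unitary $U:\mathcal{H}\to\mathcal{H}'$ with $UM_{z_i}=M_{z_i}U$ for $i=1,2$. *)

(* Defs.v *)
From HB Require Import structures.
From mathcomp Require Import all_boot all_order all_algebra.
From mathcomp Require Import all_classical all_reals all_analysis.
From mathcomp Require Import complex.

Set Implicit Arguments.
Unset Strict Implicit.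
Unset Printing Implicit Defensive.

Import Order.TTheory GRing.Theory Num.Theory.
Import numFieldNormedType.Exports.

Local Open Scope classical_set_scope.
Local Open Scope complex_scope.
Local Open Scope ring_scope.

Section ComplexDerivatives.
Variable K : numClosedFieldType.

Definition holomorphic_at (f : 'rV[K]_2 -> K) (z : 'rV[K]_2) : Prop :=
  differentiable f z.

Definition dz (i : 'I_2) (f : 'rV[K]_2 -> K) (z : 'rV[K]_2) : K :=
  'D_(delta_mx 0 i) f z.

(* For f antiholomorphic at w, d f / d (conj w_j) at w is the complex
   derivative of v |-> f (conj v) in the variable v_j at v = conj w. *)
Definition dzbar (j : 'I_2) (f : 'rV[K]_2 -> K) (w : 'rV[K]_2) : K :=
  dz j (fun v => f (map_mx Num.conj v)) (map_mx Num.conj w).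

End ComplexDerivatives.

Section ComplexFunctions.
Variable R : realType.
Local Notation C := R[i].

Definition cmod (z : C) : R := complex.Re `|z|.

Definition cexp (z : C) : C :=
  (expR (complex.Re z))%:C * (cos (complex.Im z) +i* sin (complex.Im z)).

(* the principal argument, in ]-pi, pi] for z != 0 *)
Definition carg (z : C) : R :=
  if 0 <= complex.Im z then acos (complex.Re z / cmod z)
  else - acos (complex.Re z / cmod z).

Definition clog (z : C) : C := ln (cmod z) +i* carg z.

Definition cpow (z : C) (a : R) : C := cexp (a%:C * clog z).

Definition bidisc : set 'rV[C]_2 := [set z | forall i, `|z 0 i| < 1].

End ComplexFunctions.

Section Kernels.
Variable R : realType.
Local Notation C := R[i].

Definition kerB (a b g : R) (z w : 'rV[C]_2) : C :=
  cpow (1 - z 0 0 * (w 0 0)^*) (- a) * cpow (1 - z 0 1 * (w 0 1)^*) (- b)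
  * cpow (1 - z 0 0 * (w 0 1)^*) g * cpow (1 - z 0 1 * (w 0 0)^*) g.

(* The branch of log (kerB a b g) on bidisc x bidisc that is continuous and
   vanishes at (0, 0); the principal logarithm [clog (kerB a b g z w)] can
   jump there when the exponents are large. *)
Definition log_kerB (a b g : R) (z w : 'rV[C]_2) : C :=
  - a%:C * clog (1 - z 0 0 * (w 0 0)^*) - b%:C * clog (1 - z 0 1 * (w 0 1)^*)
  + g%:C * clog (1 - z 0 0 * (w 0 1)^*) + g%:C * clog (1 - z 0 1 * (w 0 0)^*).

(* [kerB a b g] to the power h is [kerB (a * h) (b * h) (g * h)]. *)
Definition calB (a b g h : R) (z w : 'rV[C]_2) : 'M[C]_2 :=
  kerB (a * h) (b * h) (g * h) z w *:
  \matrix_(i < 2, j < 2)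
    dz i (fun z' => dzbar j (fun w' => log_kerB a b g z' w') w) z.

Definition det_calB (a b g h : R) (z w : 'rV[C]_2) : C :=
  \det (calB a b g h z w).

End Kernels.

(* A Hilbert space of functions on the bidisc: [ahm_eval f] is the function
   that f stands for, and only its values on the bidisc are meaningful. *)
Record analyticHilbertModule (R : realType) := AnalyticHilbertModule {
  ahm_space :> completeNormedModType R[i];
  ahm_dot : {dot ahm_space for Num.conj};
  ahm_dotE : forall f, ahm_dot f f = `|f| ^+ 2;
  ahm_eval : ahm_space -> 'rV[R[i]]_2 -> R[i];
  ahm_eval_linear : forall (a : R[i]) f g z, bidisc z ->
    ahm_eval (a *: f + g) z = a * ahm_eval f z + ahm_eval g z;
  ahm_eval_inj : forall f g,
    (forall z, bidisc z -> ahm_eval f z = ahm_eval g z) -> f = g;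
  ahm_holomorphic : forall f z, bidisc z -> holomorphic_at (ahm_eval f) z;
  ahm_poly : forall p : {poly {poly R[i]}},
    exists f, forall z, bidisc z -> ahm_eval f z = p.[(z 0 0)%:P].[z 0 1];
  ahm_poly_dense : dense [set f : ahm_space | exists p : {poly {poly R[i]}},
    forall z, bidisc z -> ahm_eval f z = p.[(z 0 0)%:P].[z 0 1]];
  ahm_mul : 'I_2 -> ahm_space -> ahm_space;
  ahm_mulE : forall i f z, bidisc z ->
    ahm_eval (ahm_mul i f) z = z 0 i * ahm_eval f z;
  ahm_mul_bounded : forall i, exists c : R[i], forall f,
    `|ahm_mul i f| <= c * `|f|
}.

Section HilbertModules.
Variable R : realType.
Implicit Types H : analyticHilbertModule R.

Definition has_reproducing_kernel H (K : 'rV[R[i]]_2 -> 'rV[R[i]]_2 -> R[i]) :=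
  forall w, bidisc w -> exists k : H,
    (forall z, bidisc z -> ahm_eval k z = K z w) /\
    (forall f : H, ahm_dot H f k = ahm_eval f w).

Definition unitarily_equivalent H1 H2 :=
  exists U : {linear H1 -> H2},
    [/\ bijective U,
        forall f g, ahm_dot H2 (U f) (U g) = ahm_dot H1 f g
      & forall i f, U (ahm_mul i f) = ahm_mul i (U f)].

End HilbertModules.

(* Main.v *)
Require Import Defs.
From HB Require Import structures.
From mathcomp Require Import all_boot all_order all_algebra.
From mathcomp Require Import all_classical all_reals all_analysis.
From mathcomp Require Import complex ring lra.

(* Sufficiency: if the four ratios equal [t], the first kernel is [t ^+ 2] times
   the second, so [t^-1] times the identity maps one space isometrically onto the
   other; this extends from kernel functions to the whole spaces because kernel
   functions span a dense subspace.

   Necessity: an intertwining unitary [U] is multiplication by [phi = U 1], since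
   this holds on polynomials; hence [K2 z w = phi z * (phi w)^* * K1 z w]. Both
   kernels are nonzero constants at [w = 0], so [phi] is constant and [K2 = c K1].
   On real points this is an identity between functions of
   [s = 1 - x1 * y] and [t = 1 - x2 * y]: the behaviour as [s -> 0] with [t = 1]
   determines [alpha * eta], and then [s = t] determines [gamma * eta]. The other
   product [beta * eta] is found by exchanging the two coordinates. *)

Set Implicit Arguments.
Unset Strict Implicit.
Unset Printing Implicit Defensive.

Import Order.TTheory GRing.Theory Num.Theory.
Import numFieldNormedType.Exports.

Local Open Scope classical_set_scope.
Local Open Scope complex_scope.
Local Open Scope ring_scope.

(** * The complex logarithm *)

Section ComplexLogarithm.
Variable R : realType.
Local Notation C := R[i].
Implicit Types (z u h : C) (x y : R).

Lemma cmodE z : cmod z = Num.sqrt (complex.Re z ^+ 2 + complex.Im z ^+ 2).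
Proof. by rewrite /cmod normc_def. Qed.

Lemma clog_real x : 0 < x -> clog x%:C = (ln x)%:C.
Proof.
move=> x0; rewrite /clog /carg cmodE /= lexx expr0n addr0 sqrtr_sqr.
by rewrite gtr0_norm// divff ?gt_eqF// acos1.
Qed.

Lemma cpow_real x a : 0 < x -> cpow x%:C a = (x `^ a)%:C.
Proof.
move=> x0; rewrite /cpow clog_real// -rmorphM /cexp /= sin0 cos0.
by rewrite /powR gt_eqF// complexr0 mulr1.
Qed.

(** On the right half-plane the two [acos] branches merge into one formula that is smooth across the
    real axis. *)
Lemma carg_atan z : 0 < complex.Re z ->
  carg z = atan (complex.Im z / complex.Re z).
Proof.
case: z => x y /= x0; rewrite /carg cmodE /=.
set r := Num.sqrt _.
have r0 : 0 < r by rewrite sqrtr_gt0 ltr_pwDl ?exprn_gt0// sqr_ge0.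
have cE : cos (atan (y / x)) = x / r.
  rewrite cos_atan; have -> : 1 + (y / x) ^+ 2 = (r / x) ^+ 2.
    rewrite !expr_div_n sqr_sqrtr ?addr_ge0 ?sqr_ge0// mulrDl divff//.
    by rewrite expf_neq0 ?gt_eqF.
  by rewrite sqrtr_sqr ger0_norm ?invf_div// divr_ge0// ltW.
rewrite -cE; have pi0 := pi_gt0 R.
have := atan_ltpi2 (y / x); have := atan_gtNpi2 (y / x).
case: (leP 0 y) => y0 h1 h2.
  rewrite cosK// in_itv /=.
  have : 0 <= atan (y / x) by rewrite -(@atan0 R) le_atan// divr_ge0// ltW.
  by move=> ->/=; lra.
rewrite cosKN ?opprK//.
have : atan (y / x) <= 0 by rewrite -(@atan0 R) le_atan// pmulr_lle0 ?invr_gt0// ltW.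
by move=> ->; rewrite andbT; lra.
Qed.

Lemma clogE z : 0 < complex.Re z -> clog z =
  (ln (complex.Re z ^+ 2 + complex.Im z ^+ 2) / 2)
  +i* atan (complex.Im z / complex.Re z).
Proof.
move=> z0; rewrite /clog carg_atan// cmodE; congr (_ +i* _).
have n0 : 0 < complex.Re z ^+ 2 + complex.Im z ^+ 2.
  by rewrite ltr_pwDl ?exprn_gt0// sqr_ge0.
rewrite -[in RHS](@sqr_sqrtr _ (_ + _)) ?ltW//.
by rewrite lnXn ?sqrtr_gt0// -[ln _ *+ _]mulr_natr mulfK.
Qed.

Lemma MVT01 (f df : R -> R) :
  (forall s : R, 0 <= s <= 1 -> is_derive s 1 f (df s)) ->
  exists2 s : R, 0 <= s <= 1 & f 1 - f 0 = df s.
Proof.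
move=> fd; have [||s sI E] := @MVT R f df 0 1 ltr01.
- by move=> x /[!in_itv]/= /andP[x0 x1]; apply: fd; rewrite !ltW.
- apply: derivable_within_continuous => x /[!in_itv]/= xI.
  by have [] := fd _ xI.
exists s; last by rewrite E subr0 mulr1.
by move: sI; rewrite in_itv/= => /andP[s0 s1]; rewrite !ltW.
Qed.

Lemma is_derive_affine (x p s : R) : is_derive s 1 (fun t => x + t * p) p.
Proof.
have -> : (fun t => x + t * p) = cst x + p *: id.
  by apply/funext => t; rewrite !fctE /= mulrC.
apply: (is_derive_eq (is_deriveD (is_derive_cst _ _ _)
  (is_deriveZ _ (is_derive_id _ _)))).
by rewrite add0r [_ *: _]mulr1.
Qed.

(* The mean value theorem is applied to the real and to the imaginary part along
   the segment from [u] to [u + h], which yields two intermediate points. *)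
Lemma clog_MVT u h : 0 < complex.Re u -> 0 < complex.Re (u + h) ->
  exists s s' : R, [/\ 0 <= s <= 1, 0 <= s' <= 1 & clog (u + h) - clog u =
    complex.Re (h / (u + s%:C * h)) +i* complex.Im (h / (u + s'%:C * h))].
Proof.
case: u => x y; case: h => p q /= x0 xp0.
have xs0 s : 0 <= s <= 1 -> 0 < x + s * p.
    case/andP=> s0 s1.
    have -> : x + s * p = (1 - s) * x + s * (x + p) by ring.
    have [->|s'0] := eqVneq s 0; first by rewrite subr0 mul1r mul0r addr0.
    by rewrite ltr_wpDl ?mulr_ge0 ?mulr_gt0 ?subr_ge0 ?(ltW x0)//
      lt_neqAle eq_sym s'0.
have n0 s : 0 <= s <= 1 -> 0 < (x + s * p) ^+ 2 + (y + s * q) ^+ 2.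
  by move=> sI; rewrite ltr_pwDl ?exprn_gt0 ?sqr_ge0// xs0.
(* With [u = x + iy] and [h = p + iq], the derivative below is the real part of [h / (u + s h)] in
   coordinates. The second application, to [atan], treats the imaginary part. *)
have [|s sI Es] := @MVT01
  (fun s => ln ((x + s * p) ^+ 2 + (y + s * q) ^+ 2) / 2)
  (fun s => ((x + s * p) * p + (y + s * q) * q) /
            ((x + s * p) ^+ 2 + (y + s * q) ^+ 2)).
  move=> s sI; have Dx := is_derive_affine x p s; have Dy := is_derive_affine y q s.
  pose N : R -> R := (fun t => x + t * p) ^+ 2 + (fun t => y + t * q) ^+ 2.
  have -> : (fun s => ln ((x + s * p) ^+ 2 + (y + s * q) ^+ 2) / 2) =
     2^-1 *: (@ln R \o N).
    by apply/funext => t; rewrite !fctE /= mulrC.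
  have DN : is_derive s 1 N _ := is_deriveD (is_deriveX 2 Dx) (is_deriveX 2 Dy).
  have Dl : is_derive (N s) 1 (@ln R) _ := is_derive1_ln (n0 s sI).
  apply: (is_derive_eq (is_deriveZ _ (is_derive1_comp Dl DN))).
  rewrite -?[_ *: _]/(_ * _) /=.
  by field; rewrite gt_eqF ?n0.
have [|s' sI' Es'] := @MVT01
  (fun s => atan ((y + s * q) / (x + s * p)))
  (fun s => ((x + s * p) * q - (y + s * q) * p) /
            ((x + s * p) ^+ 2 + (y + s * q) ^+ 2)).
  move=> s' sI'; have Dx := is_derive_affine x p s'.
  have Dy := is_derive_affine y q s'.
  pose Q : R -> R := (fun t => y + t * q) * (fun t => (x + t * p)^-1).
  have -> : (fun s => atan ((y + s * q) / (x + s * p))) = @atan R \o Q by [].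
  have xs0' : x + s' * p != 0 by rewrite gt_eqF// xs0.
  have Dv := @is_deriveV R (fun t => x + t * p) s' p 1 xs0' Dx.
  have DQ : is_derive s' 1 Q _ := is_deriveM Dy Dv.
  apply: (is_derive_eq (is_derive1_comp (is_derive1_atan _) DQ)).
  rewrite /Q -?[_ *: _]/(_ * _) !fctE /=.
  by field; rewrite xs0' ?gt_eqF ?n0.
exists s, s'; split=> //.
rewrite !clogE//= ; move: Es Es'; rewrite !mul1r !mul0r !addr0 => Es Es'.
apply/eqP; rewrite eq_complex /=; apply/andP; split; apply/eqP.
  by rewrite Es subr0; field; rewrite gt_eqF ?n0.
by rewrite Es' subr0; field; rewrite gt_eqF ?n0.
Qed.

Lemma Re_le_norm z : (complex.Re z)%:C <= `|z|.
Proof. by apply: le_trans (normc_ge_Re z); rewrite lecR ler_norm. Qed.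

Lemma Im_le_norm z : `|complex.Im z|%:C <= `|z|.
Proof.
rewrite normc_def lecR -sqrtr_sqr ler_sqrt ?addr_ge0 ?sqr_ge0//.
by rewrite lerDr sqr_ge0.
Qed.

Lemma Re_gt0_neighbour u h : `|h| < (complex.Re u)%:C ->
  0 < complex.Re (u + h).
Proof.
move=> hu; have := le_lt_trans (normc_ge_Re h) hu.
by rewrite ltcR ltr_norml raddfD /= => /andP[]; lra.
Qed.

(** Since [|h| <= |u| / 2], every intermediate point [u + t h] has modulus at least [|u| / 2]. The
    real and the imaginary part therefore each contribute an error of at most [2 (|h| / |u|)^2]. *)
Lemma clog_estimate u h : `|h| < (complex.Re u)%:C / 2 ->
  `|clog (u + h) - clog u - h / u| <= 4 * (`|h| / `|u|) ^+ 2.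
Proof.
move=> hu.
have u0C : 0 < (complex.Re u)%:C.
  by have := le_lt_trans (normr_ge0 h) hu; rewrite pmulr_lgt0 ?invr_gt0.
have u0 : 0 < complex.Re u by rewrite -ltcR.
have nu0 : 0 < `|u| by apply: lt_le_trans u0C (Re_le_norm u).
have un0 : u != 0 by rewrite -normr_gt0.
have uh : `|h| <= `|u| / 2.
  by apply: (le_trans (ltW hu)); rewrite ler_wpM2r ?invr_ge0// Re_le_norm.
have [|s [s' [sI sI' ->]]] := @clog_MVT u h u0.
  apply/Re_gt0_neighbour/(lt_le_trans hu).
  by rewrite ler_pdivrMr// ler_peMr ?ler1n// ltW.
have E (t : R) : 0 <= t <= 1 ->
    `|h / (u + t%:C * h) - h / u| <= 2 * (`|h| / `|u|) ^+ 2.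
  move=> /andP[t0 t1].
  have th : `|t%:C * h| <= `|h|.
    rewrite normrM ler_piMl// normc_def /= expr0n addr0 sqrtr_sqr ger0_norm//.
    by rewrite lecR.
  have uth : `|u| / 2 <= `|u + t%:C * h|.
    apply: le_trans (lerB_normD u (t%:C * h)); rewrite lerBrDr [leRHS]splitr lerD2l.
    exact: le_trans th uh.
  have uthn0 : u + t%:C * h != 0.
    by rewrite -normr_gt0 (lt_le_trans _ uth)// divr_gt0.
  have -> : h / (u + t%:C * h) - h / u = - (t%:C * h) * h / ((u + t%:C * h) * u).
    by field; rewrite un0 uthn0.
  rewrite normrM normfV !normrM normrN.
  have -> : 2 * (`|h| / `|u|) ^+ 2 = `|h| * `|h| / (`|u| / 2 * `|u|).
    by field; rewrite gt_eqF.
  apply: ler_pM; rewrite ?invr_ge0 ?mulr_ge0//.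
    by apply: ler_wpM2r.
  by rewrite lef_pV2 ?posrE ?mulr_gt0 ?normr_gt0//; apply: ler_wpM2r.
set A := h / (u + s%:C * h); set B := h / (u + s'%:C * h).
have -> : complex.Re A +i* complex.Im B - h / u =
    (complex.Re (A - h / u))%:C + 'i%C * (complex.Im (B - h / u))%:C.
  by apply/eqP; rewrite eq_complex; case: A B (h / u) => [? ?] [? ?] [? ?] /=;
    apply/andP; split; apply/eqP; ring.
apply: (le_trans (ler_normD _ _)).
rewrite normrM complexiE normCi mul1r.
have -> : 4 * (`|h| / `|u|) ^+ 2 = 2 * (`|h| / `|u|) ^+ 2 + 2 * (`|h| / `|u|) ^+ 2.
  by ring.
apply: lerD.
  apply: le_trans (E _ sI); apply: le_trans (normc_ge_Re _).
  by rewrite normc_def /= expr0n addr0 sqrtr_sqr.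
apply: le_trans (E _ sI'); apply: le_trans (Im_le_norm _).
by rewrite normc_def /= expr0n addr0 sqrtr_sqr.
Qed.

Local Notation K := (R[i] : numClosedFieldType).

Lemma is_derive_clog (u : K) : 0 < complex.Re u ->
  is_derive u (1 : K) (@clog R : K -> K) u^-1.
Proof.
move=> u0.
have u0C : 0 < (complex.Re u)%:C by rewrite ltcR.
have nu0 : 0 < `|u| by apply: lt_le_trans u0C (Re_le_norm u).
have un0 : u != 0 by rewrite -normr_gt0.
suff H : (fun h : K => h^-1 *: ((clog (h *: (1 : K) + u) : K) - clog u)) @ 0^'
    --> u^-1.
  by apply: DeriveDef; [apply/cvg_ex; exists u^-1 | apply: cvg_lim].
apply/cvgrPdist_lt => e e0.
near=> h.
have h0 : h != 0 by near: h; exact: nbhs_dnbhs_neq.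
have hu : `|h| < (complex.Re u)%:C / 2.
  near: h; by apply: dnbhs0_lt; rewrite divr_gt0.
(* This makes the remainder of [clog_estimate], once divided by [|h|], smaller than [e]. *)
have he : `|h| < e * `|u| ^+ 2 / 4.
  by near: h; apply: dnbhs0_lt; rewrite ?divr_gt0 ?mulr_gt0 ?exprn_gt0.
have := clog_estimate hu; rewrite -[_ *: _]/(_ * _) -[h *: 1]/(h * 1) mulr1.
rewrite [h + u]addrC => Eh.
have -> : u^-1 - h^-1 * (clog (u + h) - clog u) =
   - (h^-1 * (clog (u + h) - clog u - h / u)) by field; rewrite h0 un0.
rewrite normrN normrM normfV; apply: (@le_lt_trans _ _ (4 * `|h| / `|u| ^+ 2)).
  rewrite ler_pdivrMl ?normr_gt0//; apply: (le_trans Eh).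
  by rewrite le_eqVlt; apply/orP; left; apply/eqP; field; rewrite gt_eqF.
by rewrite ltr_pdivrMr ?exprn_gt0// mulrC -ltr_pdivlMr.
Unshelve. all: by end_near. Qed.

End ComplexLogarithm.

(** * Derivatives of the kernel *)

Section DirectionalDerivatives.
Variables (K : numFieldType) (V : normedModType K).
Implicit Types (f : K -> K) (g : V -> K) (x v : V).

Lemma derive_line g x v : 'D_v g x = 'D_1 (fun h : K => g (h *: v + x)) 0.
Proof.
rewrite /derive; apply: (f_equal (fun F : K -> K => lim (F @ 0^'))).
apply/funext => h.
by rewrite /= scale0r add0r addr0 [_%:A]mulr1.
Qed.

Lemma is_derive_line g x v b : is_derive x v g b <->
  is_derive (0 : K) 1 (fun h : K => g (h *: v + x)) b.
Proof.
have := derivable1P g x v; have := derive_line g x v => E D.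
by split=> -[/D dg <-]; apply: DeriveDef.
Qed.

(** Only a directional derivative of [g] is given, so everything is restricted to the line through
    [x] along [v]. There the functions have one variable, and derivability gives differentiability
    and the usual chain rule. *)
Lemma is_derive_comp1 f g x v a b : is_derive (g x) 1 f a ->
  is_derive x v g b -> is_derive x v (f \o g) (a * b).
Proof.
move=> df /is_derive_line dg; apply/is_derive_line.
set g1 : K -> K := (fun h => g (h *: v + x)) in dg *.
have gE : g x = g1 0 by rewrite /g1 scale0r add0r.
rewrite gE in df; change (is_derive (0 : K) 1 (f \o g1) (a * b)); clearbody g1.
have [/derivable1_diffP Df <-] := df; have [/derivable1_diffP Dg <-] := dg.
have D : differentiable (f \o g1) (0 : K) by exact: differentiable_comp.
split; first exact/derivable1_diffP.
have {}D := deriveE (1 : K) D; have {}dg := deriveE (1 : K) Dg.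
have {}df := deriveE (1 : K) Df.
apply: (etrans D); rewrite diff_comp// df dg mulrC /=.
by have := linearZ_LR ('d f (g1 0)) ('d g1 0 1) 1; rewrite [_%:A]mulr1.
Qed.

Lemma is_derive_inv g x v b : g x != 0 -> is_derive x v g b ->
  is_derive x v (fun y => (g y)^-1) (- b / g x ^+ 2).
Proof.
move=> g0 [dg <-]; split; first exact: derivableV.
by rewrite deriveV// -[_ *: _]/(_ * _) mulrC mulNr mulrN.
Qed.

End DirectionalDerivatives.

Lemma is_derive_coord (K : numFieldType) m n (x v : 'M[K]_(m, n)) i j :
  is_derive x v (fun y : 'M[K]_(m, n) => y i j) (v i j).
Proof.
suff H : h^-1 *: ((h *: v + x) i j - x i j) @[h --> (0 : K)^'] --> v i j.
  by split; [apply/cvg_ex; exists (v i j) | apply: cvg_lim].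
apply: cvg_near_cst; near=> h.
have h0 : h != 0 by near: h; exact: nbhs_dnbhs_neq.
by rewrite !mxE addrK -[_ *: _]/(_ * _) mulKf.
Unshelve. all: by end_near. Qed.

Lemma det_mx22 (F : comNzRingType) (A : 'M[F]_2) :
  \det A = A 0 0 * A 1 1 - A 0 1 * A 1 0.
Proof.
rewrite (expand_det_row _ 0) !big_ord_recl big_ord0 addr0 /cofactor !det_mx11.
have E1 : lift 0 0 = 1 :> 'I_2 by apply/val_inj.
have E0 : lift 1 0 = 0 :> 'I_2 by apply/val_inj.
by rewrite !mxE ?E1 ?E0 /= mul1r mulN1r mulrN.
Qed.

(** * Mixed derivatives of the logarithm of the kernel, and the determinant *)

Section KernelDerivatives.
Variable R : realType.
Local Notation K := (R[i] : numClosedFieldType).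
Implicit Types (z w v e : 'rV[K]_2).

Lemma is_derive_clog1 v e i (c : K) : 0 < complex.Re (1 - c * v 0 i) ->
  is_derive v e (fun v => clog (1 - c * v 0 i) : K)
    (- (c * e 0 i) / (1 - c * v 0 i)).
Proof.
move=> pos.
have D : is_derive v e (fun v => 1 - c * v 0 i) (- (c * e 0 i)).
  have -> : (fun v => 1 - c * v 0 i) = cst 1 - c *: (fun v : 'rV[K]_2 => v 0 i).
    by apply/funext.
  apply: (is_derive_eq (is_deriveB (is_derive_cst _ _ _)
     (is_deriveZ _ (is_derive_coord _ _ _ _)))).
  by rewrite sub0r.
apply: (is_derive_eq (@is_derive_comp1 _ _ _ (fun v => 1 - c * v 0 i) _ _ _ _
  (is_derive_clog pos) D)).
by rewrite mulrC.
Qed.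

(** Differentiating a logarithmic term in a conjugate variable leaves a multiple of this fraction,
    which the second derivative acts on. *)
Lemma is_derive_moebius z e i (c : K) : 1 - z 0 i * c != 0 ->
  is_derive z e (fun z => z 0 i / (1 - z 0 i * c))
    (e 0 i / (1 - z 0 i * c) ^+ 2).
Proof.
move=> n0.
have D : is_derive z e (fun z => 1 - z 0 i * c) (- (c * e 0 i)).
  have -> : (fun z => 1 - z 0 i * c) = cst 1 - c *: (fun v : 'rV[K]_2 => v 0 i).
    by apply/funext => y; rewrite !fctE mulrC.
  apply: (is_derive_eq (is_deriveB (is_derive_cst _ _ _)
     (is_deriveZ _ (is_derive_coord _ _ _ _)))).
  by rewrite sub0r.
have DV := @is_derive_inv _ _ (fun z => 1 - z 0 i * c) _ _ _ n0 D.
apply: (is_derive_eq (is_deriveM (is_derive_coord _ _ _ _) DV)).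
by rewrite -?[_ *: _]/(_ * _); field.
Qed.


(** This keeps the arguments of all logarithms in the right half-plane, where [clog] is
    differentiable. *)
Lemma Re_1subM_gt0 (x y : R[i]) : `|x| < 1 -> `|y| < 1 ->
  0 < complex.Re (1 - x * y).
Proof.
move=> x1 y1; apply: Re_gt0_neighbour.
by rewrite normrN normrM mulr_ilt1.
Qed.

Lemma one_subM_neq0 (x y : R[i]) : `|x| < 1 -> `|y| < 1 -> 1 - x * y != 0.
Proof.
move=> x1 y1; apply/eqP => E; have := Re_1subM_gt0 x1 y1.
by rewrite E ltxx.
Qed.

(** Closed form of the derivative of [log_kerB] in the conjugate of [w_j]. The entries of [e] act as
    Kronecker symbols, so one formula serves both values of [j]. *)
Definition dlog_kerB (a b g : R) (j : 'I_2) (z w : 'rV[K]_2) : K :=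
  let e : 'rV[K]_2 := delta_mx 0 j in
  (a%:C * e 0 0) * (z 0 0 / (1 - z 0 0 * (w 0 0)^*))
  + (b%:C * e 0 1) * (z 0 1 / (1 - z 0 1 * (w 0 1)^*))
  - (g%:C * e 0 1) * (z 0 0 / (1 - z 0 0 * (w 0 1)^*))
  - (g%:C * e 0 0) * (z 0 1 / (1 - z 0 1 * (w 0 0)^*)).

Lemma dzbar_log_kerB a b g j z w : bidisc z -> bidisc w ->
  dzbar j (fun w' => log_kerB a b g z w') w = dlog_kerB a b g j z w.
Proof.
move=> zD wD; rewrite /dzbar /dz /dlog_kerB.
set e := delta_mx _ _; set v := map_mx _ w.
have -> : (fun v => log_kerB a b g z (map_mx Num.conj v)) =
    - a%:C *: (fun v : 'rV[K]_2 => clog (1 - z 0 0 * v 0 0) : K)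
    - b%:C *: (fun v : 'rV[K]_2 => clog (1 - z 0 1 * v 0 1) : K)
    + g%:C *: (fun v : 'rV[K]_2 => clog (1 - z 0 0 * v 0 1) : K)
    + g%:C *: (fun v : 'rV[K]_2 => clog (1 - z 0 1 * v 0 0) : K).
  by apply/funext => y; rewrite /log_kerB !mxE !conjCK.
have vD i : v 0 i = (w 0 i)^* by rewrite mxE.
have pos i k : 0 < complex.Re (1 - z 0 i * v 0 k).
  by rewrite vD Re_1subM_gt0// norm_conjC.
have D i k := @is_derive_clog1 v e k (z 0 i) (pos i k).
have [_ ->] := is_deriveD (is_deriveD (is_deriveB (is_deriveZ (- a%:C) (D 0 0))
  (is_deriveZ b%:C (D 1 1))) (is_deriveZ g%:C (D 0 1))) (is_deriveZ g%:C (D 1 0)).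
rewrite -?[_ *: _]/(_ * _) !vD.
by field; rewrite !one_subM_neq0// norm_conjC.
Qed.

Lemma bidisc_near z : bidisc z -> \forall y \near z, bidisc (y : 'rV[K]_2).
Proof.
move=> zD.
have N i : \forall y \near z, `|(y : 'rV[K]_2) 0 i| < 1.
  have C := @coord_continuous K 1 2 0 i z.
  exact: (cvgr_norm_lt _ C _ (zD i)).
have NN := @filter_forall _ _ _ _ (nbhs_filter z) N.
exact: NN.
Qed.

Lemma ddlog_kerB a b g i j z w :
  let e : 'rV[K]_2 := delta_mx 0 j in let f : 'rV[K]_2 := delta_mx 0 i in
  bidisc z -> bidisc w ->
  dz i (fun z' => dzbar j (fun w' => log_kerB a b g z' w') w) z =
  a%:C * e 0 0 * f 0 0 / (1 - z 0 0 * (w 0 0)^*) ^+ 2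
  + b%:C * e 0 1 * f 0 1 / (1 - z 0 1 * (w 0 1)^*) ^+ 2
  - g%:C * e 0 1 * f 0 0 / (1 - z 0 0 * (w 0 1)^*) ^+ 2
  - g%:C * e 0 0 * f 0 1 / (1 - z 0 1 * (w 0 0)^*) ^+ 2.
Proof.
move=> e f zD wD; rewrite /dz.
(* The closed form of the inner derivative holds only on the bidisc; as the bidisc is open,
   agreement near [z] is enough. *)
have -> : 'D_(delta_mx 0 i)
    (fun z' => dzbar j (fun w' => log_kerB a b g z' w') w) z =
    'D_f (fun z' => dlog_kerB a b g j z' w) z.
  apply: near_eq_derive; have := bidisc_near zD; apply: filterS => y yD.
  exact: dzbar_log_kerB.
have wD' k : `|(w 0 k)^*| < 1 by rewrite norm_conjC.
have D k l := @is_derive_moebius z f k ((w 0 l)^*) (one_subM_neq0 (zD k) (wD' l)).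
have -> : (fun z' => dlog_kerB a b g j z' w) =
    (a%:C * e 0 0) *: (fun z : 'rV[K]_2 => z 0 0 / (1 - z 0 0 * (w 0 0)^*))
  + (b%:C * e 0 1) *: (fun z : 'rV[K]_2 => z 0 1 / (1 - z 0 1 * (w 0 1)^*))
  - (g%:C * e 0 1) *: (fun z : 'rV[K]_2 => z 0 0 / (1 - z 0 0 * (w 0 1)^*))
  - (g%:C * e 0 0) *: (fun z : 'rV[K]_2 => z 0 1 / (1 - z 0 1 * (w 0 0)^*)).
  by [].
have [_ ->] := is_deriveB (is_deriveB (is_deriveD (is_deriveZ (a%:C * e 0 0) (D 0 0))
  (is_deriveZ (b%:C * e 0 1) (D 1 1))) (is_deriveZ (g%:C * e 0 1) (D 0 1)))
  (is_deriveZ (g%:C * e 0 0) (D 1 0)).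
rewrite -?[_ *: _]/(_ * _).
by field; rewrite !one_subM_neq0 ?norm_conjC.
Qed.

(** The [a] and [b] terms of the mixed derivatives lie on the diagonal and the [g] terms off it. The
    scalar factor is squared because the matrix has size 2. *)
Lemma det_calBE a b g h z w : bidisc z -> bidisc w ->
  det_calB a b g h z w = kerB (a * h) (b * h) (g * h) z w ^+ 2 *
   ((a * b)%:C / ((1 - z 0 0 * (w 0 0)^*) ^+ 2 * (1 - z 0 1 * (w 0 1)^*) ^+ 2)
   - (g ^+ 2)%:C / ((1 - z 0 0 * (w 0 1)^*) ^+ 2 * (1 - z 0 1 * (w 0 0)^*) ^+ 2)).
Proof.
move=> zD wD; rewrite /det_calB /calB detZ; congr (_ * _).
have -> : \matrix_(i, j)
    dz i (fun z' => dzbar j (fun w' => log_kerB a b g z' w') w) z =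
  \matrix_(i < 2, j < 2) (
    a%:C * (j == 0)%:R * (i == 0)%:R / (1 - z 0 0 * (w 0 0)^*) ^+ 2
    + b%:C * (j == 1)%:R * (i == 1)%:R / (1 - z 0 1 * (w 0 1)^*) ^+ 2
    - g%:C * (j == 1)%:R * (i == 0)%:R / (1 - z 0 0 * (w 0 1)^*) ^+ 2
    - g%:C * (j == 0)%:R * (i == 1)%:R / (1 - z 0 1 * (w 0 0)^*) ^+ 2 : K).
  apply/matrixP => i j; rewrite !mxE; apply: (etrans (ddlog_kerB a b g i j zD wD)).
  by rewrite !mxE !eqxx /= ![_ == j]eq_sym ![_ == i]eq_sym.
rewrite det_mx22 !mxE /=.
have n0 i j : 1 - z 0 i * (w 0 j)^* != 0 by rewrite one_subM_neq0 ?norm_conjC.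
move: (1 - _) (n0 0 0) => p p0.
move: (1 - _) (n0 0 1) => q q0.
move: (1 - _) (n0 1 0) => r r0.
move: (1 - _) (n0 1 1) => t t0.
rewrite rmorphM rmorphXn /=.
by field; rewrite p0 q0 r0 t0.
Qed.

End KernelDerivatives.

(** * Real points *)

Lemma one_powR (R : realType) (x : R) : 1 `^ x = 1.
Proof. by rewrite powR1. Qed.

Section RealPoints.
Variable R : realType.
Implicit Types (A G p q s t c : R).

(* The kernel with [A = a * h], [G = g * h], [p = a * b], [q = g ^+ 2] at the
   points [z = (x1, x2)], [w = (y, 0)] with real coordinates, where
   [s = 1 - x1 * y] and [t = 1 - x2 * y] are independent parameters. *)
Definition real_kernel A G p q s t : R :=
  (s `^ (- A) * t `^ G) ^+ 2 * (p / s ^+ 2 - q / t ^+ 2).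

(** If [A2 < A1], the right side grows faster than the left as [s] tends to 0, by a factor of order
    [s^(-2 (A1 - A2))]. One sufficiently small [s] gives the contradiction, so no limit is taken. *)
Lemma exponent_le A1 A2 p1 q1 p2 q2 c : 0 < q1 < p1 -> 0 < q2 < p2 ->
  c * (p1 - q1) = p2 - q2 ->
  (forall s, 0 < s <= 1 -> real_kernel A2 0 p2 q2 s 1 =
     c * real_kernel A1 0 p1 q1 s 1) ->
  A1 <= A2.
Proof.
move=> /andP[q10 qp1] /andP[q20 qp2] cE H; rewrite leNgt; apply/negP => A21.
have p20 : 0 < p2 by lra.
have c0 : 0 < c by rewrite -(@pmulr_lgt0 _ (p1 - q1)) ?subr_gt0// cE subr_gt0.
pose d := A1 - A2; have d0 : 0 < d by rewrite subr_gt0.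
(* With [s = e^(1/d)], cancelling common powers gives [e^2 (p2 - q2 s^2) = c (p1 - q1 s^2)]. The
   right side is at least [p2 - q2], while the left is at most [e p2], which this choice makes half
   of [p2 - q2]. *)
pose e := (p2 - q2) / (2 * p2).
have e0 : 0 < e by rewrite divr_gt0 ?mulr_gt0// subr_gt0.
have e1 : e < 1 by rewrite ltr_pdivrMr ?mulr_gt0//; lra.
have s0 : 0 < e `^ d^-1 by rewrite powR_gt0.
have s1 : e `^ d^-1 <= 1.
    by rewrite -(one_powR d^-1) ge0_ler_powR ?nnegrE ?invr_ge0 ?ltW.
have := H _ (introT andP (conj s0 s1)); rewrite /real_kernel !powRr0 !mulr1.
set s := e `^ d^-1 in s0 s1 *.
have sd : s `^ (- A2) = e * s `^ (- A1).
  have -> : - A2 = d + - A1 by rewrite /d; ring.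
  rewrite powRD; last by rewrite (gt_eqF s0) implybT.
  congr (_ * _).
  by rewrite /s -powRrM mulVf ?gt_eqF// powRr1// ltW.
rewrite sd expr1n !divr1; set u := s `^ (- A1).
have u0 : 0 < u by rewrite powR_gt0.
move=> E.
have {}E : e ^+ 2 * (p2 - q2 * s ^+ 2) = c * (p1 - q1 * s ^+ 2).
  have k0 : u ^+ 2 / s ^+ 2 != 0 by rewrite gt_eqF// divr_gt0 ?exprn_gt0.
  apply: (mulfI k0); move: E.
  have -> : (e * u) ^+ 2 * (p2 / s ^+ 2 - q2) =
    u ^+ 2 / s ^+ 2 * (e ^+ 2 * (p2 - q2 * s ^+ 2)) by field; rewrite gt_eqF.
  by move=> ->; field; rewrite gt_eqF.
have ss : s ^+ 2 <= 1 by rewrite expr_le1// ltW.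
have ss0 : 0 < s ^+ 2 by rewrite exprn_gt0.
have E1 : p2 - q2 <= c * (p1 - q1 * s ^+ 2).
  by rewrite -cE ler_pM2l// lerD2l lerN2 ler_piMr// ltW.
have E2 : e ^+ 2 * (p2 - q2 * s ^+ 2) <= e * p2.
  rewrite expr2 -mulrA ler_pM2l//.
  apply: (@le_trans _ _ (1 * p2)); last by rewrite mul1r.
  by apply: ler_pM; rewrite ?(ltW e0) ?(ltW e1)//; nra.
have E3 : e * p2 = (p2 - q2) / 2 by rewrite /e; field; rewrite gt_eqF.
lra.
Qed.

Lemma real_kernel_exponents A1 A2 G1 G2 p1 q1 p2 q2 c :
  0 < q1 < p1 -> 0 < q2 < p2 ->
  (forall s t, 0 < s <= 1 -> 0 < t <= 1 -> real_kernel A2 G2 p2 q2 s t =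
     c * real_kernel A1 G1 p1 q1 s t) ->
  A1 = A2 /\ G1 = G2.
Proof.
move=> pq1 pq2 H.
have I1 : 0 < (1 : R) <= 1 by rewrite ltr01 lexx.
(* All powers are 1 at [s = t = 1], which determines [c] and shows that it is positive. *)
have cE : c * (p1 - q1) = p2 - q2.
  have := H 1 1 I1 I1.
  by rewrite /real_kernel !one_powR ?mulr1 !expr1n !divr1 !mul1r.
have [/andP[q10 qp1] /andP[q20 qp2]] := (pq1, pq2).
have c0 : 0 < c by rewrite -(@pmulr_lgt0 _ (p1 - q1)) ?subr_gt0// cE subr_gt0.
have E0 A G p q s : real_kernel A G p q s 1 = real_kernel A 0 p q s 1.
  by rewrite /real_kernel !one_powR.
have AE : A1 = A2.
  apply/eqP; rewrite eq_le; apply/andP; split.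
    apply: (exponent_le pq1 pq2 cE) => s sI.
    by rewrite -(E0 _ G2) -(E0 _ G1) H.
  (* The reverse inequality comes from exchanging the two kernels and inverting [c]. *)
  apply: (@exponent_le A2 A1 p2 q2 p1 q1 c^-1) => //.
    by rewrite -cE mulKf ?gt_eqF.
  by move=> s sI; rewrite -(E0 _ G1) -(E0 _ G2) H// mulKf ?gt_eqF.
(* On the diagonal [s = t] each bracket is [(p - q) / s^2], so [cE] cancels them and only the powers
   with exponents [G1] and [G2] remain. The value 1/2 is used because its logarithm is nonzero. *)
split=> //; have h0 : 0 < (2^-1 : R) by rewrite invr_gt0.
have hI : 0 < (2^-1 : R) <= 1 by rewrite h0 invf_le1// ler1n.
have := H _ _ hI hI; rewrite /real_kernel -AE.
set u := _ `^ (- A1); have u0 : 0 < u by rewrite powR_gt0.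
have -> : p2 / 2^-1 ^+ 2 - q2 / 2^-1 ^+ 2 = c * (p1 - q1) / 2^-1 ^+ 2.
  by rewrite cE -mulrBl.
set v1 := _ `^ G1; set v2 := _ `^ G2 => E.
have v10 : 0 < v1 by rewrite powR_gt0.
have v20 : 0 < v2 by rewrite powR_gt0.
have {}E : v2 ^+ 2 = v1 ^+ 2.
  have k0 : u ^+ 2 * c * (p1 - q1) / 2^-1 ^+ 2 != 0.
    by rewrite gt_eqF// divr_gt0 ?mulr_gt0 ?exprn_gt0// subr_gt0.
  apply: (mulfI k0); rewrite -[LHS]/(_ * _).
  have -> : u ^+ 2 * c * (p1 - q1) / 2^-1 ^+ 2 * v2 ^+ 2 =
    (u * v2) ^+ 2 * (c * (p1 - q1) / 2^-1 ^+ 2) by ring.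
  by rewrite E; ring.
have {}E : v1 = v2 by apply/eqP; rewrite -(@eqrXn2 _ 2)// ?ltW// E.
have := congr1 (@ln R) E; rewrite !ln_powR => /mulIf; apply.
by rewrite lnV ?posrE// oppr_eq0 gt_eqF// ln_gt0// ltr1n.
Qed.

End RealPoints.

(** * The kernel at points with real coordinates *)

Section KernelAtRealPoints.
Variable R : realType.
Local Notation C := R[i].
Implicit Types (x y : R).

Definition real_point x y : 'rV[C]_2 := \row_i (if i == 0 then x%:C else y%:C).

Lemma real_point_bidisc x y : `|x| < 1 -> `|y| < 1 -> bidisc (real_point x y).
Proof.
move=> x1 y1 i; rewrite mxE normc_def; case: ifP => _ /=;
by rewrite expr0n addr0 sqrtr_sqr ltcR.
Qed.

Lemma conj_real x : (x%:C : C)^* = x%:C.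
Proof. by have := conjc_real x. Qed.

Lemma det_calB_real a b g h x1 x2 y1 y2 :
  `|x1| < 1 -> `|x2| < 1 -> `|y1| < 1 -> `|y2| < 1 ->
  det_calB a b g h (real_point x1 x2) (real_point y1 y2) =
  (((1 - x1 * y1) `^ (- (a * h)) * (1 - x2 * y2) `^ (- (b * h)) *
   (1 - x1 * y2) `^ (g * h) * (1 - x2 * y1) `^ (g * h)) ^+ 2 *
   (a * b / ((1 - x1 * y1) ^+ 2 * (1 - x2 * y2) ^+ 2) -
    g ^+ 2 / ((1 - x1 * y2) ^+ 2 * (1 - x2 * y1) ^+ 2)))%:C.
Proof.
move=> x1D x2D y1D y2D.
rewrite det_calBE; [|exact: real_point_bidisc..].
rewrite /kerB !mxE /= !conj_real.
have E x y : 1 - x%:C * y%:C = (1 - x * y)%:C by rewrite rmorphB rmorph1 rmorphM.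
have pos x y : `|x| < 1 -> `|y| < 1 -> 0 < 1 - x * y.
  move=> xD yD; rewrite subr_gt0; apply: le_lt_trans (ler_norm _) _.
  by rewrite normrM mulr_ilt1.
rewrite !E !cpow_real ?pos//.
by rewrite -!rmorphM -!rmorphXn -!rmorphM -!fmorph_div -rmorphB -rmorphM.
Qed.

(** Taking [w = (u, 0)] turns two of the four factors into 1 and leaves a [real_kernel] with
    exponents [a h] and [g h]; taking [w = (0, u)] gives [b h] and [g h]. *)
Lemma exponents_of_proportional_kernels a1 b1 g1 h1 a2 b2 g2 h2 (c : C) :
  0 < g1 -> g1 < a1 -> g1 < b1 -> 0 < g2 -> g2 < a2 -> g2 < b2 ->
  (forall z w : 'rV[C]_2, bidisc z -> bidisc w ->
    det_calB a2 b2 g2 h2 z w = c * det_calB a1 b1 g1 h1 z w) ->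
  [/\ a1 * h1 = a2 * h2, b1 * h1 = b2 * h2 & g1 * h1 = g2 * h2].
Proof.
move=> g10 ga1 gb1 g20 ga2 gb2 H.
have pq1 : 0 < g1 ^+ 2 < a1 * b1 by rewrite exprn_gt0//= expr2 ltr_pM// ltW.
have pq2 : 0 < g2 ^+ 2 < a2 * b2 by rewrite exprn_gt0//= expr2 ltr_pM// ltW.
have n0 : `|0 : R| < 1 by rewrite normr0.
(* At the origin both kernels are nonzero real numbers, so [c] is real. *)
have [r cE] : exists r : R, c = r%:C.
  have := H _ _ (real_point_bidisc n0 n0) (real_point_bidisc n0 n0).
  rewrite !det_calB_real// !mul0r !subr0 !one_powR ?mulr1 !expr1n !mul1r !divr1 => E.
  exists ((a2 * b2 - g2 ^+ 2) / (a1 * b1 - g1 ^+ 2)).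
  rewrite fmorph_div; apply: (canRL (mulfK _)); last exact: esym E.
  by rewrite fmorph_eq0 subr_eq0; case/andP: pq1 => _ /gt_eqF->.
have {}H x1 x2 y1 y2 (x1D : `|x1| < 1) (x2D : `|x2| < 1) (y1D : `|y1| < 1)
  (y2D : `|y2| < 1) := H _ _ (real_point_bidisc x1D x2D) (real_point_bidisc y1D y2D).
have coords s t : 0 < s <= 1 -> 0 < t <= 1 -> exists x y u : R,
    [/\ `|x| < 1, `|y| < 1, `|u| < 1, s = 1 - x * u & t = 1 - y * u].
  (* This [u] is below 1 and still exceeds both [1 - s] and [1 - t], so the two quotients by [u] lie
     in the unit interval. *)
  move=> /andP[s0 s1] /andP[t0 t1]; pose u := 1 - Num.min s t / 2.
  have m0 : 0 < Num.min s t by rewrite lt_min s0.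
  have ms : Num.min s t <= s by rewrite ge_min lexx.
  have mt : Num.min s t <= t by rewrite ge_min lexx orbT.
  have u0 : 0 < u by rewrite /u; lra.
  exists ((1 - s) / u), ((1 - t) / u), u; rewrite !divfK ?gt_eqF//.
  split; [| | |ring|ring].
  - by rewrite ger0_norm ?divr_ge0 ?subr_ge0// ?ltW// ltr_pdivrMr// /u; lra.
  - by rewrite ger0_norm ?divr_ge0 ?subr_ge0// ?ltW// ltr_pdivrMr// /u; lra.
  - by rewrite ger0_norm ?ltW// /u; lra.
have [|BE _] := @real_kernel_exponents R (b1 * h1) (b2 * h2) (g1 * h1) (g2 * h2)
  (a1 * b1) (g1 ^+ 2) (a2 * b2) (g2 ^+ 2) r pq1 pq2.
  move=> s t sI tI; have [x [y [u [xD yD uD -> ->]]]] := coords s t sI tI.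
  (* The coordinates are exchanged, so that [s] goes with the exponent of [b]. *)
  have := H y x 0 u yD xD n0 uD.
  rewrite cE !det_calB_real// -rmorphM => /complexI.
  by rewrite !mulr0 !subr0 !one_powR ?mulr1 !expr1n ?mulr1 ?mul1r.
have [|AE GE] := @real_kernel_exponents R (a1 * h1) (a2 * h2) (g1 * h1) (g2 * h2)
  (a1 * b1) (g1 ^+ 2) (a2 * b2) (g2 ^+ 2) r pq1 pq2; last by split.
move=> s t sI tI; have [x [y [u [xD yD uD -> ->]]]] := coords s t sI tI.
have := H x y u 0 xD yD uD n0.
rewrite cE !det_calB_real// -rmorphM => /complexI.
  by rewrite !mulr0 !subr0 !one_powR ?mulr1 !expr1n ?mulr1 ?mul1r.
Qed.

End KernelAtRealPoints.

(** * Unitaries from equal Gram matrices *)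

Lemma complex_gt0P (R : realType) (e : R[i]) : 0 < e ->
  exists2 r : R, 0 < r & e = r%:C.
Proof.
move=> e0; have E : e = (complex.Re e)%:C by rewrite RRe_real// gtr0_real.
by exists (complex.Re e) => //; move: e0; rewrite E ltcR.
Qed.

Section InnerProduct.
Variables (R : realType) (H : completeNormedModType R[i]).
Variable dot : {dot H for Num.conj}.
Hypothesis dotE : forall x, dot x x = `|x| ^+ 2.
Implicit Types (x y v : H) (S : set H).

Lemma dot_sym x y : dot x y = (dot y x)^*.
Proof. by rewrite hermC expr0 mul1r. Qed.

Lemma dotBl x y v : dot (x - y) v = dot x v - dot y v.
Proof. by rewrite linearBl. Qed.

Lemma dotPl a x y v : dot (a *: x + y) v = a * dot x v + dot y v.
Proof. by rewrite linearPl. Qed.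

Lemma dotZr x y a : dot x (a *: y) = a^* * dot x y.
Proof. by rewrite [LHS]linearZr_LR. Qed.

Lemma parallelogram x y :
  `|x + y| ^+ 2 + `|x - y| ^+ 2 = 2 * `|x| ^+ 2 + 2 * `|y| ^+ 2.
Proof. by rewrite -!dotE hnormD hnormB; ring. Qed.

Lemma normB_sqr x y :
  `|x - y| ^+ 2 = `|x| ^+ 2 + `|y| ^+ 2 - (dot x y + (dot x y)^*).
Proof. by rewrite -!dotE; have := hnormB dot x y; rewrite /= mul1r. Qed.

(** Pythagoras for the projection [t *: v] of [x] onto the line of [v], multiplied through by
    [|v|^2] to avoid a division. *)
Lemma Bessel x v (t : R[i]) : t * `|v| ^+ 2 = dot x v ->
  `|x - t *: v| ^+ 2 * `|v| ^+ 2 = `|x| ^+ 2 * `|v| ^+ 2 - `|dot x v| ^+ 2.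
Proof.
rewrite normB_sqr dotZr normrZ exprMn => <-.
have : (`|v| ^+ 2)^* = `|v| ^+ 2 by rewrite conj_Creal ?rpredX ?normr_real.
move: (`|v| ^+ 2) => p pE; rewrite !normCK !rmorphM /= conjCK pE.
by ring.
Qed.

Lemma Cauchy_Schwarz x v : `|dot x v| <= `|x| * `|v|.
Proof.
have [->|v0] := eqVneq v 0; first by rewrite linear0r !normr0 mulr0.
rewrite -(@ler_pXn2r _ 2) ?nnegrE ?mulr_ge0// exprMn -subr_ge0.
rewrite -(@Bessel x v (dot x v / `|v| ^+ 2)) ?mulr_ge0 ?exprn_ge0//.
by rewrite divfK// expf_neq0// normr_eq0.
Qed.

Lemma dot_cvg (u : nat -> H) x v :
  u @ \oo --> x -> (fun n => dot (u n) v) @ \oo --> dot x v.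
Proof.
move=> ux; apply/cvgrPdist_lt => e e0.
have k0 : 0 < `|v| + 1 by rewrite ltr_wpDl.
have /cvgrPdist_lt /(_ (e / (`|v| + 1))) := ux.
rewrite divr_gt0// => /(_ isT); apply: filterS => n nE.
rewrite -linearBl; apply: le_lt_trans (Cauchy_Schwarz _ _) _.
rewrite ltr_pdivlMr// in nE; apply: le_lt_trans nE.
by rewrite ler_wpM2l// lerDl.
Qed.

Lemma cauchy_seq_cvg (u : nat -> H) :
  (forall e : R, 0 < e -> exists N, forall n, (N <= n)%N ->
    `|u N - u n| < e%:C) -> exists x, u @ \oo --> x.
Proof.
move=> uC; suff /cauchy_cvg /cvg_ex : cauchy (u @ \oo) by [].
apply/cauchy_exP => _ /complex_gt0P[r r0 ->].
have [N NE] := uC _ r0; exists (u N), N => // n /= Nn.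
by rewrite -ball_normE; apply: NE.
Qed.

(** Here [d] is the infimum of the squared distances from [x] to [S]. Norms take values in [R[i]],
    so real parts are taken to form this infimum in [R]. *)
Lemma minimizing_sequence S x : S 0 -> exists d : R, exists2 u : nat -> H,
  forall n, S (u n) /\ `|x - u n| ^+ 2 <= (d + n.+1%:R^-1)%:C &
  forall y, S y -> d%:C <= `|x - y| ^+ 2.
Proof.
move=> S0; pose E := [set complex.Re (`|x - y| ^+ 2) | y in S].
have rE (y : H) : (complex.Re (`|x - y| ^+ 2))%:C = `|x - y| ^+ 2.
  by rewrite RRe_real// rpredX// normr_real.
have Elb : has_lbound E.
  by exists 0 => _ [y Sy <-]; rewrite -lecR rE rmorph0 exprn_ge0.
have Einf : has_inf E by split=> //; exists (complex.Re (`|x - 0| ^+ 2)), 0.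
have /choice[u uP] : forall n : nat, exists y,
    S y /\ `|x - y| ^+ 2 <= (inf E + n.+1%:R^-1)%:C.
  move=> n; have n0 : 0 < n.+1%:R^-1 :> R by rewrite invr_gt0 ltr0n.
  have [_ [y Sy <-] yE] := inf_adherent n0 Einf.
  by exists y; split=> //; rewrite -rE lecR ltW.
exists (inf E), u => // y Sy.
by rewrite -rE lecR; apply: ge_inf => //; exists y.
Qed.

Lemma small_invS (b r : R) : 0 <= b -> 0 < r ->
  exists N, forall n, (N <= n)%N -> n.+1%:R^-1 * b < r.
Proof.
move=> b0 r0; have e0 : 0 < r / (b + 1) by rewrite divr_gt0// ltr_wpDl.
have [N _ NE] := near_infty_natSinv_lt (PosNum e0).
exists N => n Nn; have := NE n Nn; rewrite /= ltr_pdivlMr ?ltr_wpDl//.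
by apply: le_lt_trans; rewrite ler_wpM2l ?invr_ge0// lerDl.
Qed.

(** The projection argument without closing [S]: midpoints stay in [S], so by the parallelogram law
    a minimizing sequence is Cauchy. With [x'] its limit, [x - x'] is orthogonal to [S], hence
    zero. *)
Lemma total_subspace_dense S : S 0 ->
  (forall a x y, S x -> S y -> S (a *: x + y)) ->
  (forall x, (forall y, S y -> dot x y = 0) -> x = 0) ->
  forall x, exists2 u : nat -> H, forall n, S (u n) & u @ \oo --> x.
Proof.
move=> S0 Slin Stot x; have [d [u uP dP]] := minimizing_sequence x S0.
pose g n : R := n.+1%:R^-1.
have [|x' ux'] := @cauchy_seq_cvg u.
  (* The parallelogram law will bound [|u N - u n|^2] by [4 (d + g N) - 4 d = 4 g N]. *)
  move=> e e0; have [N NE] := @small_invS 4 _ (ler0n _ _) (exprn_gt0 2 e0).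
  exists N => n Nn; rewrite -(@ltr_pXn2r _ 2) ?nnegrE ?lecR ?(ltW e0)//.
  have -> : `|u N - u n| ^+ 2 = 2 * `|x - u n| ^+ 2 + 2 * `|x - u N| ^+ 2
      - 4 * `|x - 2^-1 *: (u n + u N)| ^+ 2.
    rewrite -parallelogram; have -> : x - u n - (x - u N) = u N - u n.
      by rewrite opprB addrC addrA subrK.
    have -> : x - u n + (x - u N) = 2 *: (x - 2^-1 *: (u n + u N)).
      rewrite scalerBr scalerA divff// scale1r scaler_nat mulr2n opprD.
      by rewrite addrACA.
    by rewrite normrZ normr_nat exprMn; ring.
  have [Sn En] := uP n; have [SN EN] := uP N.
  have gnN : g n <= g N by rewrite lef_pV2 ?posrE ?ltr0n// ler_nat.
  have M : d%:C <= `|x - 2^-1 *: (u n + u N)| ^+ 2.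
    apply: dP; rewrite -[_ *: _]addr0; apply: (Slin) => //.
    by rewrite -[u n]scale1r; apply: Slin.
  apply: (@le_lt_trans _ _ (2 * (d + g N)%:C + 2 * (d + g N)%:C - 4 * d%:C)).
    apply: lerB; last by rewrite ler_pM2l.
    apply: lerD; rewrite ler_pM2l//.
    by apply: le_trans En _; rewrite lecR lerD2l.
  rewrite rmorphD /=.
  have -> : 2 * (d%:C + (g N)%:C) + 2 * (d%:C + (g N)%:C) - 4 * d%:C = (g N * 4)%:C.
    by rewrite rmorphM rmorph_nat; ring.
  by rewrite -rmorphXn ltcR; apply: NE.
suff -> : x = x' by exists u => // n; have [] := uP n.
apply/eqP; rewrite -subr_eq0; apply/eqP/Stot => y Sy.
have L1 : (fun n => dot (x - u n) y) @ \oo --> dot (x - x') y.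
  by apply: dot_cvg; apply: cvgB => //; exact: cvg_cst.
suff L0 : (fun n => dot (x - u n) y) @ \oo --> (0 : (R[i] : numFieldType)).
  exact: (cvg_unique (@norm_hausdorff _ _) L1 L0).
apply/cvgrPdist_lt => _ /complex_gt0P[r r0 ->].
have [b bE] : exists b : R, `|y| ^+ 2 = b%:C.
  by exists (complex.Re (`|y| ^+ 2)); rewrite RRe_real// rpredX// normr_real.
have b0 : 0 <= b by rewrite -lecR -bE exprn_ge0.
have [N NE] := small_invS b0 (exprn_gt0 2 r0).
exists N => // n /= Nn; rewrite sub0r normrN.
rewrite -(@ltr_pXn2r _ 2) ?nnegrE ?normr_ge0 ?lecR ?(ltW r0)//.
have -> : r%:C ^+ 2 = (r ^+ 2)%:C :> R[i] by rewrite rmorphXn.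
apply: (@le_lt_trans _ _ (g n * b)%:C); last by rewrite ltcR NE.
have [Sn En] := uP n.
have [y0|y0] := eqVneq y 0.
  by rewrite y0 linear0r normr0 expr0n lecR mulr_ge0// invr_ge0.
have ny0 : `|y| ^+ 2 != 0 by rewrite expf_neq0// normr_eq0.
(* The vector [u n + t *: y] also lies in [S], so its squared distance to [x] is at least [d]. Then
   [Bessel] bounds the squared inner product by [g n * |y|^2]. *)
pose t := dot (x - u n) y / `|y| ^+ 2.
have B := @Bessel (x - u n) y t (divfK ny0 _).
have -> : `|dot (x - u n) y| ^+ 2 = `|x - u n| ^+ 2 * `|y| ^+ 2 -
   `|x - u n - t *: y| ^+ 2 * `|y| ^+ 2 by rewrite B; ring.
rewrite rmorphM /= -bE -mulrBl ler_wpM2r ?exprn_ge0//.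
have -> : (g n)%:C = (d + g n)%:C - d%:C :> R[i] by rewrite rmorphD; ring.
apply: lerB => //; rewrite -addrA -opprD; apply: dP.
by rewrite addrC; apply: Slin.
Qed.

End InnerProduct.

(** * Approximation by linear combinations of a total family *)

Definition lincomb (R : realType) (V : normedModType R[i]) (I : Type)
    (k : I -> V)
    (s : seq (R[i] * I)) : V :=
  \sum_(p <- s) p.1 *: k p.2.

Definition total_family (R : realType) (H : completeNormedModType R[i])
    (dot : {dot H for Num.conj}) (I : Type) (k : I -> H) :=
  forall f, (forall i, dot f (k i) = 0) -> f = 0.

Section TotalFamily.
Variables (R : realType) (H : completeNormedModType R[i]).
Variable dot : {dot H for Num.conj}.
Hypothesis dotE : forall x, dot x x = `|x| ^+ 2.
Variables (I : Type) (k : I -> H).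
Hypothesis k_total : total_family dot k.

Lemma dot_lincombl s g :
  dot (lincomb k s) g = \sum_(p <- s) p.1 * dot (k p.2) g.
Proof.
rewrite /lincomb linear_sumlz; apply: eq_bigr => p _.
by rewrite [LHS]linearZl_LR.
Qed.

(** Coefficient lists are produced rather than vectors, so that the same coefficients can be used
    with another family. *)
Lemma lincomb_dense (f : H) : exists s : nat -> seq (R[i] * I),
  (fun n => lincomb k (s n) : H) @ \oo --> f.
Proof.
have [||| u uP uf] := @total_subspace_dense R H dot dotE (range (lincomb k)) _ _ _ f.
- by exists [::] => //; rewrite /lincomb big_nil.
- move=> a _ _ [s _ <-] [s' _ <-].
  exists ([seq (a * p.1, p.2) | p <- s] ++ s') => //.
  rewrite /lincomb big_cat big_map; congr (_ + _).
  by rewrite scaler_sumr; apply: eq_bigr => p _; rewrite scalerA.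
- move=> g gP; apply: k_total => i; apply: gP.
  by exists [:: (1, i)] => //; rewrite /lincomb big_seq1 scale1r.
have /choice[s sP] : forall n, exists s, lincomb k s = u n.
  by move=> n; have [s _ sE] := uP n; exists s.
by exists s; under eq_fun do rewrite sP.
Qed.

Lemma total_eq f g : (forall i, dot f (k i) = dot g (k i)) -> f = g.
Proof.
move=> fg; apply/eqP; rewrite -subr_eq0; apply/eqP/k_total => i.
by rewrite dotBl fg subrr.
Qed.

End TotalFamily.

Section GramTransfer.
Variables (R : realType) (H1 H2 : completeNormedModType R[i]).
Variables (dot1 : {dot H1 for Num.conj}) (dot2 : {dot H2 for Num.conj}).
Hypothesis dot1E : forall x, dot1 x x = `|x| ^+ 2.
Hypothesis dot2E : forall x, dot2 x x = `|x| ^+ 2.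
Variables (I : Type) (k1 : I -> H1) (k2 : I -> H2).
Hypothesis k1_total : total_family dot1 k1.
Hypothesis k12 : forall i j, dot1 (k1 i) (k1 j) = dot2 (k2 i) (k2 j).

(** The combinations of [k1] tending to [f] have the same mutual distances as the corresponding
    combinations of [k2], whose limit is [g]. Matching pairs [f'], [g'] include [k1 i], [k2 i] as
    well as transferred vectors. *)
Lemma transfer_vector (f : H1) : exists g : H2, forall f' g',
  (forall i, dot1 f' (k1 i) = dot2 g' (k2 i)) -> dot1 f f' = dot2 g g'.
Proof.
have [s sf] := lincomb_dense dot1E k1_total f.
have normE t : `|lincomb k1 t| = `|lincomb k2 t|.
  apply/eqP; rewrite -(@eqrXn2 _ 2)// -dot1E -dot2E !dot_lincombl.
  apply/eqP; apply: eq_bigr => p _; rewrite dot_sym [in RHS]dot_sym.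
  rewrite !dot_lincombl; congr (_ * _^*); apply: eq_bigr => q _.
  by rewrite k12.
(* A difference of combinations is again a combination, with coefficients independent of the family,
   so [normE] applies to it. *)
have lincombB (V : completeNormedModType R[i]) (k : I -> V) t t' :
    lincomb k t - lincomb k t' = lincomb k (t ++ [seq (- p.1, p.2) | p <- t']).
  rewrite /lincomb big_cat big_map; congr (_ + _).
  by rewrite -sumrN; apply: eq_bigr => p _; rewrite scaleNr.
have [|g gP] := @cauchy_seq_cvg R H2 (fun n => lincomb k2 (s n) : H2).
  move=> e e0; have e20 : 0 < (e / 2)%:C by rewrite ltcR divr_gt0.
  have /cvgrPdist_lt/(_ _ e20)[N _ NE] := sf.
  exists N => n Nn; rewrite lincombB -normE -lincombB.
  have -> : lincomb k1 (s N) - lincomb k1 (s n) =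
      (f - lincomb k1 (s n)) - (f - lincomb k1 (s N)).
    by rewrite opprB [RHS]addrC addrA subrK.
  apply: le_lt_trans (ler_normB _ _) _.
  have -> : e%:C = (e / 2)%:C + (e / 2)%:C by rewrite -rmorphD -splitr.
  by apply: ltrD; apply: NE => /=.
exists g => f' g' fg.
have L1 := dot_cvg dot1E (v := f') sf; have L2 := dot_cvg dot2E (v := g') gP.
have E : (fun n => dot1 (lincomb k1 (s n)) f') =
    (fun n => dot2 (lincomb k2 (s n)) g').
  apply/funext => n; rewrite !dot_lincombl; apply: eq_bigr => p _.
  by rewrite dot_sym fg -dot_sym.
by rewrite E in L1; exact: (cvg_unique (@norm_hausdorff _ _) L1 L2).
Qed.

End GramTransfer.

Section GramUnitary.
Variables (R : realType) (H1 H2 : completeNormedModType R[i]).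
Variables (dot1 : {dot H1 for Num.conj}) (dot2 : {dot H2 for Num.conj}).
Hypothesis dot1E : forall x, dot1 x x = `|x| ^+ 2.
Hypothesis dot2E : forall x, dot2 x x = `|x| ^+ 2.
Variables (I : Type) (k1 : I -> H1) (k2 : I -> H2).
Hypothesis k1_total : total_family dot1 k1.
Hypothesis k2_total : total_family dot2 k2.
Hypothesis k12 : forall i j, dot1 (k1 i) (k1 j) = dot2 (k2 i) (k2 j).

(** Images are chosen vector by vector, and the inverse by exchanging the two spaces. Linearity and
    the remaining identities follow by testing against the total families. *)
Lemma same_gram_unitary : exists U : {linear H1 -> H2}, [/\ bijective U,
  forall f g, dot2 (U f) (U g) = dot1 f g & forall i, U (k1 i) = k2 i].
Proof.
have /choice[U UP] := transfer_vector dot1E dot2E k1_total k12.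
have /choice[V VP] := transfer_vector dot2E dot1E k2_total
  (fun i j => esym (k12 i j)).
have Uk f i : dot2 (U f) (k2 i) = dot1 f (k1 i).
  by rewrite (UP f (k1 i) (k2 i)).
have Vk f i : dot1 (V f) (k1 i) = dot2 f (k2 i).
  by rewrite (VP f (k2 i) (k1 i)).
have U_linear : linear U.
  move=> a f g; apply: (total_eq k2_total) => i.
  by rewrite dotPl !Uk dotPl.
pose Ul := GRing.isLinear.Build _ _ _ _ U U_linear.
pose UL : {linear H1 -> H2} := HB.pack U Ul.
exists UL; split.
- exists V => f; [apply: (total_eq k1_total)|apply: (total_eq k2_total)] => i.
    by rewrite Vk Uk.
  by rewrite Uk Vk.
- by move=> f g; rewrite -(UP f g) // => i; rewrite Uk.
- move=> i; apply: (total_eq k2_total) => j.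
  by rewrite Uk k12.
Qed.

End GramUnitary.

(** * Kernels of unitarily equivalent modules *)

Section HilbertModules.
Variable R : realType.
Local Notation C := R[i].
Implicit Types (H : analyticHilbertModule R) (K : 'rV[C]_2 -> 'rV[C]_2 -> C).

Lemma kernel_family H K : has_reproducing_kernel H K ->
  exists k : {w : 'rV[C]_2 | bidisc w} -> H,
    (forall i z, bidisc z -> ahm_eval (k i) z = K z (sval i)) /\
    (forall f i, ahm_dot H f (k i) = ahm_eval f (sval i)).
Proof.
move=> HK; have /choice[k kP] : forall i : {w : 'rV[C]_2 | bidisc w},
    exists k : H, (forall z, bidisc z -> ahm_eval k z = K z (sval i)) /\
    (forall f, ahm_dot H f k = ahm_eval f (sval i)).
  by case=> w wD; exact: HK.
by exists k; split=> [i|f i]; have [] := kP i.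
Qed.

Lemma eval0 H z : bidisc z -> ahm_eval (0 : H) z = 0.
Proof.
move=> zD; have := @ahm_eval_linear _ H (-1) 0 0 z zD.
by rewrite scaler0 addr0 mulN1r addNr.
Qed.

Lemma evalZ H a (f : H) z : bidisc z -> ahm_eval (a *: f) z = a * ahm_eval f z.
Proof. by move=> zD; rewrite -[_ *: _]addr0 ahm_eval_linear// eval0// addr0. Qed.

Lemma evalB H (f g : H) z : bidisc z ->
  ahm_eval (f - g) z = ahm_eval f z - ahm_eval g z.
Proof.
by move=> zD; rewrite addrC -scaleN1r ahm_eval_linear// mulN1r addrC.
Qed.

(** A vector orthogonal to every kernel function vanishes on the bidisc, and its values there
    determine it. *)
Lemma kernel_family_total H (k : {w : 'rV[C]_2 | bidisc w} -> H) :
  (forall f i, ahm_dot H f (k i) = ahm_eval f (sval i)) ->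
  total_family (ahm_dot H) k.
Proof.
move=> kP f f0; apply: ahm_eval_inj => z zD; rewrite eval0//.
by have := f0 (exist _ z zD); rewrite kP.
Qed.

Lemma proportional_kernels_equivalent H1 H2 K1 K2 (t : R) : t != 0 ->
  has_reproducing_kernel H1 K1 -> has_reproducing_kernel H2 K2 ->
  (forall z w, bidisc z -> bidisc w -> K1 z w = (t ^+ 2)%:C * K2 z w) ->
  unitarily_equivalent H1 H2.
Proof.
move=> t0 /kernel_family[k1 [k1E k1P]] /kernel_family[k2 [k2E k2P]] K12.
have tC0 : t%:C != 0 :> C by rewrite fmorph_eq0.
have tJ : (t%:C : C)^* = t%:C by exact: conj_real.
have k2'P f i : ahm_dot H2 f (t%:C *: k2 i) = t%:C * ahm_eval f (sval i).
  by rewrite dotZr k2P tJ.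
have [||i j|U [Ubij Udot Uk]] := same_gram_unitary (@ahm_dotE _ H1) (@ahm_dotE _ H2)
    (k1 := k1) (k2 := fun i => t%:C *: k2 i).
- exact: kernel_family_total k1P.
- move=> f f0; apply: (kernel_family_total k2P) => i.
  by have /eqP := f0 i; rewrite k2'P mulf_eq0 (negbTE tC0) -k2P => /eqP.
- case: i j => [w wD] [z zD]; rewrite k1P k1E//= k2'P evalZ// k2E//= K12//.
  by rewrite mulrA -expr2 rmorphXn.
(* Pairing [U f] with [t *: k2], the image of [k1], shows that [U] divides values by [t]; hence it
   commutes with the coordinate multiplications. *)
have UE f z : bidisc z -> ahm_eval (U f) z = t%:C^-1 * ahm_eval f z.
  move=> zD; apply: (mulfI tC0); rewrite mulVKf//.
  have := Udot f (k1 (exist _ z zD)); rewrite Uk k2'P k1P /= => ->.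
  by [].
exists U; split=> // i f; apply: ahm_eval_inj => z zD.
by rewrite ahm_mulE// !UE// ahm_mulE// mulrCA.
Qed.

Lemma bounded_eval H K w : has_reproducing_kernel H K -> bidisc w ->
  exists2 c : C, 0 <= c & forall f : H, `|ahm_eval f w| <= c * `|f|.
Proof.
move=> HK wD; have [k [_ kP]] := HK _ wD; exists `|k| => // f.
by rewrite -kP mulrC; exact: Cauchy_Schwarz (@ahm_dotE _ H) _ _.
Qed.

Section Intertwiner.
Variables (H1 H2 : analyticHilbertModule R) (U : {linear H1 -> H2}).
Hypothesis UM : forall i f, U (ahm_mul i f) = ahm_mul i (U f).

(** Induction on the Horner form [q * X + c]: multiplication by [X] is a coordinate multiplication,
    which [U] respects. The outer variable is the first coordinate; the coefficients, polynomials in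
    the second, need an induction of their own. *)
Lemma intertwiner_poly (f1 : H1) (p : {poly {poly C}}) (f : H1) :
  (forall z, bidisc z -> ahm_eval f1 z = 1) ->
  (forall z, bidisc z -> ahm_eval f z = p.[(z 0 0)%:P].[z 0 1]) ->
  forall z, bidisc z -> ahm_eval (U f) z = ahm_eval (U f1) z * ahm_eval f z.
Proof.
move=> f1E.
have polyC_case (c : {poly C}) (g : H1) :
    (forall z, bidisc z -> ahm_eval g z = c.[z 0 1]) ->
    forall z, bidisc z -> ahm_eval (U g) z = ahm_eval (U f1) z * ahm_eval g z.
  elim/poly_ind: c g => [|q a IH] g gE z zD.
    have -> : g = 0 by apply: ahm_eval_inj => y yD; rewrite gE// horner0 eval0.
    by rewrite linear0 !eval0// mulr0.
  have [g' g'E] := @ahm_poly _ H1 q%:P.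
  have {}g'E y : bidisc y -> ahm_eval g' y = q.[y 0 1].
    by move=> yD; rewrite g'E// hornerC.
  have -> : g = a *: f1 + ahm_mul 1 g'.
    apply: ahm_eval_inj => y yD.
    rewrite gE// ahm_eval_linear// f1E// ahm_mulE// g'E//.
    by rewrite hornerMXaddC mulr1 addrC mulrC.
  rewrite linearP UM !ahm_eval_linear// !ahm_mulE// (IH g')// f1E//.
  by ring.
elim/poly_ind: p f => [|q c IH] f fE z zD.
  have -> : f = 0 by apply: ahm_eval_inj => y yD; rewrite fE// !horner0 eval0.
  by rewrite linear0 !eval0// mulr0.
have [g gE] := @ahm_poly _ H1 q.
have [g' g'E] := @ahm_poly _ H1 c%:P.
have {}g'E y : bidisc y -> ahm_eval g' y = c.[y 0 1].
  by move=> yD; rewrite g'E// hornerC.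
have -> : f = 1 *: ahm_mul 0 g + g'.
  apply: ahm_eval_inj => y yD.
  rewrite fE// ahm_eval_linear// ahm_mulE// g'E// gE//.
  by rewrite hornerMXaddC hornerD hornerM hornerC mul1r mulrC.
rewrite scale1r linearD UM -[ahm_mul 0 g]scale1r -[ahm_mul 0 (U g)]scale1r.
rewrite !ahm_eval_linear// !ahm_mulE// (IH g)// (polyC_case _ _ g'E)//.
by ring.
Qed.

End Intertwiner.

(** The formula for [U] on polynomials extends by density and bounded evaluations. The adjoint then
    sends the kernel function of [H2] at [w] to the conjugate of [phi w] times that of [H1], and
    applying [U] again relates the kernels. *)
Lemma unitary_equivalence_multiplier H1 H2 K1 K2 :
  has_reproducing_kernel H1 K1 -> has_reproducing_kernel H2 K2 ->
  unitarily_equivalent H1 H2 ->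
  exists phi : 'rV[C]_2 -> C, forall z w, bidisc z -> bidisc w ->
    K2 z w = phi z * (phi w)^* * K1 z w.
Proof.
move=> HK1 HK2 [U [[V UK VK] Udot UM]].
have [f1 f1E] := @ahm_poly _ H1 1.
have {}f1E z : bidisc z -> ahm_eval f1 z = 1.
  by move=> zD; rewrite f1E// !hornerC.
pose phi := ahm_eval (U f1).
have Unorm f : `|U f| = `|f|.
  by apply/eqP; rewrite -(@eqrXn2 _ 2)// -!ahm_dotE Udot.
have UE f z : bidisc z -> ahm_eval (U f) z = phi z * ahm_eval f z.
  move=> zD.
  have [c1 c10 c1P] := bounded_eval HK1 zD.
  have [c2 c20 c2P] := bounded_eval HK2 zD.
  (* Both evaluations at [z] of an error [f - g] are controlled by [b * |f - g|]; the added 1 makes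
     [b] positive. *)
  pose b := c2 + `|phi z| * c1 + 1.
  have b0 : 0 < b by rewrite ltr_wpDl// addr_ge0// mulr_ge0.
  apply/eqP; rewrite -subr_eq0 -normr_le0; apply/ler_addgt0Pl => e e0.
  rewrite addr0.
  have eb0 : 0 < e / b by rewrite divr_gt0.
  have [g [gf [p pE]]] : exists g : H1, ball f (e / b) g /\
     exists p : {poly {poly C}}, forall z, bidisc z ->
       ahm_eval g z = p.[(z 0 0)%:P].[z 0 1].
    have [g [? ?]] := @ahm_poly_dense _ H1 (ball f (e / b))
      (ex_intro _ f (ballxx f eb0)) (ball_open f (e / b)).
    by exists g.
  have -> : ahm_eval (U f) z - phi z * ahm_eval f z =
      ahm_eval (U (f - g)) z - phi z * ahm_eval (f - g) z.
    rewrite linearB !evalB// (intertwiner_poly UM f1E pE)// -/phi.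
    by rewrite mulrBr; ring.
  apply: (le_trans (ler_normB _ _)); rewrite normrM.
  apply: (@le_trans _ _ (b * `|f - g|)).
    rewrite /b !mulrDl -addrA; apply: lerD; first by rewrite -Unorm.
    rewrite -mulrA; apply: (le_trans (ler_wpM2l _ (c1P _))) => //.
    by rewrite lerDl mul1r.
  rewrite mulrC -ler_pdivlMr// ltW//.
  by move: gf; rewrite -ball_normE.
exists phi => z w zD wD.
have [k1 [k1E k1P]] := HK1 _ wD; have [k2 [k2E k2P]] := HK2 _ wD.
(* As [U] is unitary, [V] is its adjoint. It suffices that both sides have the same inner product
   with their difference [d]. *)
have E : V k2 = (phi w)^* *: k1.
  apply/eqP; rewrite -subr_eq0 -normr_eq0 -sqrf_eq0 -ahm_dotE.
  set d := V k2 - _; have D : ahm_dot H1 d (V k2) = ahm_dot H1 d ((phi w)^* *: k1).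
    by rewrite -Udot VK k2P UE// dotZr k1P conjCK.
  by rewrite {2}/d linearBr /= D subrr.
by rewrite -k2E// -(VK k2) UE// E evalZ// k1E// mulrA.
Qed.

End HilbertModules.

(** At [w = 0] all four factors are 1, so the value does not depend on [z]; this is what forces the
    multiplier to be constant. *)
Lemma det_calB_0r (R : realType) (a b g h : R) (z : 'rV[R[i]]_2) : bidisc z ->
  det_calB a b g h z 0 = (a * b - g ^+ 2)%:C.
Proof.
move=> zD; have bd0 : bidisc (0 : 'rV[R[i]]_2) by move=> i; rewrite mxE normr0.
rewrite det_calBE// /kerB !mxE !rmorph0 !mulr0 !subr0.
have one x : cpow (1 : R[i]) x = 1.
  by have := @cpow_real R 1 x ltr01; rewrite one_powR.
by rewrite !one !mulr1 !expr1n !mulr1 !divr1 mul1r rmorphB.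
Qed.

Theorem theorem4p5 (R : realType)
    (a1 b1 g1 h1 a2 b2 g2 h2 : R)
    (a1_gt0 : 0 < a1) (b1_gt0 : 0 < b1) (g1_gt0 : 0 < g1) (h1_gt0 : 0 < h1)
    (a2_gt0 : 0 < a2) (b2_gt0 : 0 < b2) (g2_gt0 : 0 < g2) (h2_gt0 : 0 < h2)
    (g1_lt_a1 : g1 < a1) (g1_lt_b1 : g1 < b1)
    (g2_lt_a2 : g2 < a2) (g2_lt_b2 : g2 < b2)
    (H1 H2 : analyticHilbertModule R)
    (H1_kernel : has_reproducing_kernel H1 (det_calB a1 b1 g1 h1))
    (H2_kernel : has_reproducing_kernel H2 (det_calB a2 b2 g2 h2)) :
  unitarily_equivalent H1 H2 <->
  [/\ a1 / a2 = b1 / b2, b1 / b2 = g1 / g2 & g1 / g2 = h2 / h1].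
Proof.
split=> [U12|[ab bg gh]].
- have [phi phiP] := unitary_equivalence_multiplier H1_kernel H2_kernel U12.
  pose r1 := a1 * b1 - g1 ^+ 2; pose r2 := a2 * b2 - g2 ^+ 2.
  have r20 : r2 != 0 by rewrite subr_eq0 gt_eqF// expr2 ltr_pM// ltW.
  have bd0 : bidisc (0 : 'rV[R[i]]_2) by move=> i; rewrite mxE normr0.
  have phi0 z : bidisc z -> r2%:C = phi z * (phi 0)^* * r1%:C.
    by move=> zD; have := phiP z 0 zD bd0; rewrite !det_calB_0r.
  (* The product in [phi0] is the same for all [z], and the factor multiplying [phi z] is nonzero
     because [r2] is. *)
  have phi_cst z : bidisc z -> phi z = phi 0.
    move=> zD; have := phi0 0 bd0; rewrite (phi0 z zD) -!mulrA => /mulIf; apply.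
    apply: contra_neq r20 => E; apply/complexI.
    by rewrite (phi0 _ bd0) -mulrA E mulr0.
  have [||||||z w zD wD|aE bE gE] := @exponents_of_proportional_kernels R
    a1 b1 g1 h1 a2 b2 g2 h2 (phi 0 * (phi 0)^*) => //.
    by rewrite phiP// !phi_cst.
  have E x y : 0 < y -> x * h1 = y * h2 -> x / y = h2 / h1.
    move=> y0 xy; apply/eqP; rewrite eqr_div ?lt0r_neq0//.
    by rewrite xy mulrC.
  by rewrite !E.
(* With this common ratio the products [a h], [b h], [g h] agree for the two modules, so the power
   factors coincide and the bracket scales by [t^2]. *)
- pose t := h2 / h1; have t0 : t != 0 by rewrite mulf_neq0 ?invr_eq0 ?gt_eqF.
  have aE : a1 = t * a2 by rewrite /t -gh -bg -ab divfK ?gt_eqF.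
  have bE : b1 = t * b2 by rewrite /t -gh -bg divfK ?gt_eqF.
  have gE : g1 = t * g2 by rewrite /t -gh divfK ?gt_eqF.
  have hE : h2 = t * h1 by rewrite /t divfK ?gt_eqF.
  apply: (proportional_kernels_equivalent t0 H1_kernel H2_kernel) => z w zD wD.
  rewrite !det_calBE// aE bE gE hE.
  have E x : t * x * h1 = x * (t * h1) by ring.
  rewrite !E [RHS]mulrCA; congr (_ * _).
  move: (_ ^+ 2 * _ ^+ 2) (_ ^+ 2 * _ ^+ 2) => p q.
  by rewrite !(rmorphM, rmorphXn) /=; ring.
Qed.
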